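(* 1. Every monoid whose quotient group is a rank-one torsion-free group and that is not a group is isomorphic to a Puiseux monoid. 2. For every subgroup $Q$ of $(\mathbb Q,+)$ there is a Puiseux valuation monoid $V$ such that $\mathsf q(V) = Q$. 3. For every nontrivial Puiseux valuation monoid $V$ there exists a strongly primary monoid $H$ such that $\widehat H = V$ and $(H : \widehat H) \neq \emptyset$. Under the Continuum Hypothesis, the set of isomorphism classes of strongly primary globally tame Puiseux monoids has the cardinality of the continuum. 4. For every nontrivial Puiseux valuation monoid $V$ that is not isomorphic to $(\mathbb N_0,+)$, there exists a strongly primary Puiseux monoid $H$ such that $\widehat H = V$, $\Lambda(H) < \infty$, and $(H : \widehat H) = \emptyset$. Under the Continuum Hypothesis, the set of isomorphism classes of strongly primary Puiseux monoids that are locally tame but not globally tame has the cardinality of the continuum.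
   Context: A monoid is a commutative cancellative semigroup with identity; here monoids are written additively. A Puiseux monoid is a submonoid of $(\mathbb Q_{\ge 0}, +)$; it is nontrivial if it is not $\{0\}$. $\mathbb N$ is the set of positive integers and $\mathsf q(H)$ is the quotient group of $H$. A monoid $H$ is a valuation monoid if for all $a,b \in H$ either $b \in a+H$ or $a \in b+H$; a Puiseux valuation monoid is a Puiseux monoid that is a valuation monoid. Let $H^\times$ be the group of invertible elements of $H$. $H$ is strongly primary if $H \ne H^\times$ and for each $a \in H \setminus H^\times$ there is $n \in \mathbb N$ such that every sum of $n$ elements of $H\setminus H^\times$ lies in $a+H$. (Strongly primary monoids are atomic.) The complete integral closure is $\widehat H = \{x \in \mathsf q(H) : \text{there is } c \in H \text{ with } c+nx \in H \text{ for all } n \in \mathbb N\}$, and the conductor is $(H : \widehat H) = \{x \in \mathsf q(H) : x + \widehat H \subset H\}$. For an atomic Puiseux monoid $H$: an atom is a nonzero element that is not a sum of two nonzero elements of $H$; $\mathcal A(H)$ is the set of atoms. A factorization of $a \in H$ is a finite multiset $z$ of atoms with sum $a$; $|z|$ is its cardinality with multiplicities; $\mathsf Z(a)$ is the set of factorizations of $a$, and $\mathsf L(a) = \{|z| : z \in \mathsf Z(a)\}$. For $z,z' \in \mathsf Z(a)$, removing the largest common sub-multiset leaves disjoint multisets of sizes $m$ and $n$, and $\mathsf d(z,z') = \max\{m,n\}$. For $u \in \mathcal A(H)$, $\mathsf t(H,u)$ is the smallest $N \in \mathbb N_0 \cup \{\infty\}$ such that: for each $a \in H$ having a factorization that contains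 $u$, and each $z \in \mathsf Z(a)$, there is $z' \in \mathsf Z(a)$ containing $u$ with $\mathsf d(z,z') \le N$. $H$ is locally tame if $\mathsf t(H,u) < \infty$ for all $u \in \mathcal A(H)$, and globally tame if $\sup\{\mathsf t(H,u) : u \in \mathcal A(H)\} < \infty$. Further, $\Lambda(H) = \sup\{\min \mathsf L(a) : a \in H\} \in \mathbb N_0 \cup \{\infty\}$. *)

(* Defs.v *)
From mathcomp Require Import all_boot all_order all_algebra.
From mathcomp Require Import finmap multiset.
From mathcomp Require Import all_classical all_reals ereal.

Set Implicit Arguments.
Unset Strict Implicit.
Unset Printing Implicit Defensive.

Import Order.TTheory GRing.Theory Num.Theory.

Local Open Scope mset_scope.
Local Open Scope classical_set_scope.
Local Open Scope card_scope.
Local Open Scope ring_scope.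

Definition cancellative (M : nmodType) := forall a : M, injective (+%R a).

(* Additive monoids occur either as a type [M : nmodType] or as a subset of a
   group; in the first case they are passed below as [set: M]. *)

Definition isomorphic (M N : nmodType) (A : set M) (B : set N) :=
  exists f : M -> N,
    [/\ f 0 = 0, {in A &, {morph f : x y / x + y}} & set_bij A B f].

Definition invertibles (M : nmodType) (H : set M) : set M :=
  [set a | H a /\ exists2 b, H b & a + b = 0].

Definition translate (M : nmodType) (a : M) (H : set M) : set M :=
  [set a + x | x in H].

Definition valuation_monoid (M : nmodType) (H : set M) :=
  forall a b, H a -> H b -> translate a H b \/ translate b H a.

Definition strongly_primary (M : nmodType) (H : set M) :=
  H <> invertibles H /\
  forall a, (H `\` invertibles H) a ->
    exists2 n : nat, (0 < n)%N &
      forall x : 'I_n -> M, (forall i, (H `\` invertibles H) (x i)) ->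
        translate a H (\sum_i x i).

Section GroupSubsets.
Context {G : zmodType}.
Implicit Types H K : set G.

(* The quotient group q(H), realized inside the ambient group. *)
Definition quot H : set G := [set x | exists a b, [/\ H a, H b & x = a - b]].

Definition complete_integral_closure H : set G :=
  [set x | quot H x /\
     exists2 c, H c & forall n : nat, (0 < n)%N -> H (c + x *+ n)].

Definition conductor H K : set G :=
  [set x | quot H x /\ translate x K `<=` H].

End GroupSubsets.

(* [G], with the embedding [i], is a quotient group of the monoid [M]; it is
   unique up to isomorphism over [M]. *)
Definition is_quotient_group (M : nmodType) (G : zmodType)
    (i : {additive M -> G}) :=
  injective i /\ quot (range i) = setT.

Definition torsion_free (G : zmodType) :=
  forall (x : G) (n : nat), (0 < n)%N -> x *+ n = 0 -> x = 0.

Definition Zindependent (G : zmodType) (n : nat) (x : 'I_n -> G) :=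
  forall c : 'I_n -> int, \sum_i x i *~ c i = 0 -> forall i, c i = 0.

(* The rank is the largest size of a Z-independent family. *)
Definition has_rank (G : zmodType) (r : nat) :=
  (exists x : 'I_r -> G, Zindependent x) /\
  (forall x : 'I_r.+1 -> G, ~ Zindependent x).

Definition puiseux_monoid (H : set rat) :=
  GRing.nmod_closed [in H] /\ forall x, H x -> 0 <= x.

Definition puiseux_valuation_monoid (V : set rat) :=
  puiseux_monoid V /\ valuation_monoid V.

Definition strongly_primary_puiseux (H : set rat) :=
  puiseux_monoid H /\ strongly_primary H.

Section Factorizations.
Variable H : set rat.

Definition atoms : set rat :=
  [set u | [/\ H u, u <> 0 &
     forall a b, H a -> H b -> a <> 0 -> b <> 0 -> u <> a + b]].

Definition factorizations (a : rat) : set {mset rat} :=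
  [set z | (forall u, u \in z -> atoms u) /\ \sum_(u <- z) u = a].

Definition lengths (a : rat) : set nat :=
  [set size z | z in factorizations a].

Definition distance (z z' : {mset rat}) : nat :=
  let g := msetI z z' in maxn (size (msetB z g)) (size (msetB z' g)).

Definition tame_bound (u : rat) (N : nat) :=
  forall a, H a ->
    (exists2 z, factorizations a z & u \in z) ->
    forall z, factorizations a z ->
      exists z', [/\ factorizations a z', u \in z' & (distance z z' <= N)%N].

(* Minima and suprema in N_0 \cup {oo} are computed in the extended reals; the
   infimum of a set of naturals is its minimum, and +oo if it is empty. *)
Variable R : realType.

Definition tame_degree (u : rat) : \bar R :=
  ereal_inf [set N%:R%:E | N in tame_bound u].

Definition locally_tame := forall u, atoms u -> (tame_degree u < +oo)%E.

Definition globally_tame :=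
  (ereal_sup [set tame_degree u | u in atoms] < +oo)%E.

Definition min_length (a : rat) : \bar R :=
  ereal_inf [set n%:R%:E | n in lengths a].

Definition Lambda : \bar R := ereal_sup [set min_length a | a in H].

End Factorizations.

Definition puiseux_iso_class (H : set rat) : set (set rat) :=
  [set K | puiseux_monoid K /\ isomorphic H K].

Definition iso_classes (P : set (set rat)) : set (set (set rat)) :=
  [set puiseux_iso_class H | H in P].

Definition continuum_hypothesis (R : realType) :=
  forall A : set R, countable A \/ A #= [set: R].

(* Main.v *)
(* A valuation submonoid [V] of the nonnegative rationals is the set of
   nonnegative elements of its quotient group.

   - For [v > 0] in [V], the monoid [H] made of [0] and the elements of [V] above
     [v] has conductor containing [v], and its atoms lie in [[v, 2v)].  Three
     atoms always exceed [u + v] for an atom [u], so that at most three atoms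
     have to be exchanged to make [u] appear.
   - If [V] is not discrete, its quotient group [G] is an increasing union of
     subgroups [G_0, G_1, ...] with [G_0 = Z e]; let [w x] be the first [k] with
     [x] in [G_k], and let [H] consist of [0] and of the [x] in [G] such that
     [(w x + 1) e <= x].  Elements just above [0] may have arbitrarily large
     weight, so the conductor is empty.  Every element of [H] is a sum of at most
     five atoms, which with strong primarity gives local tameness; but making an
     atom [u] of weight [k] appear in a sum of copies of [e] consumes more than
     [k] of them.
   - An isomorphism of Puiseux monoids is multiplication by a rational, so sets
     of primes containing 2 give pairwise nonisomorphic localizations of [Z], whose
     monoids [H] form continuum many isomorphism classes. *)

Require Import Defs.
From mathcomp Require Import all_boot all_order all_algebra.
From mathcomp Require Import finmap multiset.
From mathcomp Require Import all_classical all_reals ereal.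
From mathcomp Require Import zify lra.

Set Implicit Arguments.
Unset Strict Implicit.
Unset Printing Implicit Defensive.

Import Order.TTheory GRing.Theory Num.Theory.

Local Open Scope classical_set_scope.
Local Open Scope card_scope.
Local Open Scope ring_scope.

(** * Puiseux monoids: quotient groups, units and valuation monoids *)

Lemma puiseux_monoidP (H : set rat) :
  puiseux_monoid H <->
  [/\ H 0, forall x y, H x -> H y -> H (x + y) & forall x, H x -> 0 <= x].
Proof.
split=> [[[H0 HD] Hge0]|[H0 HD Hge0]].
  split=> // [|x y Hx Hy]; first by move: H0; rewrite inE.
  by have := HD x y; rewrite !inE; apply.
split=> //; split; first by rewrite inE.
by move=> x y; rewrite !inE; apply: HD.
Qed.

Section PuiseuxMonoid.
Context {H : set rat}.
Hypothesis pmH : puiseux_monoid H.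

Lemma pm0 : H 0. Proof. by case/puiseux_monoidP: pmH. Qed.

Lemma pmD x y : H x -> H y -> H (x + y).
Proof. by case/puiseux_monoidP: pmH => _ + _; apply. Qed.

Lemma pm_ge0 x : H x -> 0 <= x.
Proof. by case/puiseux_monoidP: pmH => _ _; apply. Qed.

Lemma pmMn x n : H x -> H (x *+ n).
Proof.
by move=> Hx; elim: n => [|n IHn]; rewrite ?mulr0n ?mulrS; [apply: pm0|apply: pmD].
Qed.

Lemma pm_sum (s : seq rat) : (forall x, x \in s -> H x) -> H (\sum_(x <- s) x).
Proof.
move=> Hs; rewrite big_seq; elim/big_ind: _ => //; first exact: pm0.
exact: pmD.
Qed.

Lemma pm_quot x : H x -> quot H x.
Proof. by move=> Hx; exists x, 0; split=> //; [apply: pm0|rewrite subr0]. Qed.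

Lemma quot0 : quot H 0. Proof. exact/pm_quot/pm0. Qed.

Lemma quotB x y : quot H x -> quot H y -> quot H (x - y).
Proof.
move=> [a [b [Ha Hb ->]]] [c [d [Hc Hd ->]]].
by exists (a + d), (b + c); split; [apply: pmD|apply: pmD|lra].
Qed.

Lemma quotN x : quot H x -> quot H (- x).
Proof. by move=> ?; rewrite -sub0r; apply: quotB => //; apply: quot0. Qed.

Lemma quotD x y : quot H x -> quot H y -> quot H (x + y).
Proof. by move=> ? ?; rewrite -[y]opprK; apply/quotB/quotN. Qed.

Lemma invertibles_puiseux x : invertibles H x <-> x = 0.
Proof.
split=> [[/pm_ge0 x0 [y /pm_ge0 y0 xy]]|->]; first by lra.
by split; [apply: pm0|exists 0; rewrite ?addr0 //; apply: pm0].
Qed.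

Lemma noninvertibles_puiseux x : (H `\` invertibles H) x <-> H x /\ x <> 0.
Proof.
rewrite /setD /=; split=> -[Hx x0]; split=> //.
  by rewrite -invertibles_puiseux.
by rewrite invertibles_puiseux.
Qed.

Lemma strongly_primary_puiseuxI :
    (exists2 x, H x & x <> 0) ->
    (forall a, H a -> a <> 0 -> exists n : nat,
       forall x : 'I_n -> rat, (forall i, H (x i) /\ x i <> 0) ->
         H (\sum_i x i - a)) ->
  strongly_primary_puiseux H.
Proof.
move=> [h Hh h0] sp; split=> //; split.
  by move=> eqH; apply: h0; apply/invertibles_puiseux; rewrite -eqH.
move=> a /noninvertibles_puiseux[Ha a0].
(* Here [n] may be zero, while strong primarity asks for a positive number; one further summand,
   itself in [H], makes up for it. *)
have [n nP] := sp a Ha a0; exists n.+1 => // x xP.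
exists (\sum_i x i - a); last by rewrite addrC subrK.
rewrite big_ord_recr /= addrAC.
have HxP i : H (x i) /\ x i <> 0 by apply/noninvertibles_puiseux/xP.
by apply: pmD; [apply: nP|case: (HxP ord_max)].
Qed.

End PuiseuxMonoid.

(** For [a - b >= 0], either [a] lies in [b + V], which puts the difference in [V], or [b] lies in
    [a + V], which forces [a = b]. *)
Lemma valuation_monoid_quot (V : set rat) x : puiseux_valuation_monoid V ->
  V x <-> quot V x /\ 0 <= x.
Proof.
move=> [pmV vV]; split=> [Vx|[[a [b [Va Vb ->]]] ab0]].
  by split; [apply: pm_quot|apply: (pm_ge0 pmV)].
have [[y Vy yE]|[y Vy yE]] := vV a b Va Vb; last first.
  by have -> : a - b = y by lra.
have y0 := pm_ge0 pmV Vy; have -> : a - b = 0 by lra.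
exact: pm0.
Qed.

Lemma nonneg_valuation_monoid (Q : set rat) : GRing.zmod_closed [in Q] ->
  puiseux_valuation_monoid [set x | Q x /\ 0 <= x] /\
  quot [set x | Q x /\ 0 <= x] = Q.
Proof.
move=> [Q0 QB].
have {}Q0 : Q 0 by move: Q0; rewrite inE.
have {}QB x y : Q x -> Q y -> Q (x - y).
  by move=> Qx Qy; have := QB x y; rewrite !inE; apply.
have QN x : Q x -> Q (- x) by rewrite -sub0r; exact: QB.
have QD x y : Q x -> Q y -> Q (x + y).
  by move=> Qx Qy; rewrite -[y]opprK; apply: QB => //; apply: QN.
split; first split.
- apply/puiseux_monoidP; split=> //= [|x []] //.
  by move=> x y [Qx x0] [Qy y0]; split; [apply: QD|lra].
- move=> a b [Qa a0] [Qb b0]; have [ab|ba] := leP a b.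
    by left; exists (b - a); [split; [apply: QB|lra]|lra].
  by right; exists (a - b); [split; [apply: QB|lra]|lra].
apply/seteqP; split=> [x [a [b [[Qa _] [Qb _] ->]]]|x Qx]; first exact: QB.
have [x0|x0] := leP 0 x.
  by exists x, 0; split=> //=; rewrite ?subr0.
exists 0, (- x); split=> //=; rewrite ?sub0r ?opprK //; split; [exact: QN|lra].
Qed.

(** * Rank-one torsion-free groups inside the rationals *)

Lemma torsion_freeMz {G : zmodType} (x : G) (n : int) : torsion_free G ->
  n != 0 -> x *~ n = 0 -> x = 0.
Proof.
move=> tfG; case: n => n n0; first by move=> xn; apply: (tfG x n) => //; rewrite lt0n.
by rewrite NegzE mulrNz => /eqP; rewrite oppr_eq0 => /eqP; apply: tfG.
Qed.

(** For an independent [g], the pair [g, y] is dependent, and the coefficient of [y] cannot vanish;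
    so [n y = m g] with [n != 0], and [y] is sent to [m / n]. *)
Lemma rank_one_embedding (G : zmodType) : torsion_free G -> has_rank G 1 ->
  exists2 phi : G -> rat, {morph phi : x y / x + y} & injective phi.
Proof.
move=> tfG [[u uind] nind].
set g := u ord0.
have gind (c : int) : g *~ c = 0 -> c = 0.
  by move=> gc; apply: (uind (fun=> c) _ ord0); rewrite big_ord1.
have ratio (y : G) : exists mn : int * int, mn.2 != 0 /\ y *~ mn.2 = g *~ mn.1.
  have := nind (fun i => if i == ord0 then g else y).
  rewrite /Zindependent => /existsNP[c /not_implyP[]].
  rewrite big_ord_recl big_ord1 /= => rel /existsNP[i ci].
  exists (- c ord0, c (lift ord0 ord0)); split=> /=; last first.
    by rewrite mulrNz; apply/eqP; rewrite -addr_eq0 addrC rel.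
  apply/eqP => c1; apply: ci; move: rel; rewrite c1 mulr0z addr0 => /gind c0.
  by case: (unliftP ord0 i) => [j ->|-> //]; rewrite ord1.
have [mn mnP] := choice ratio.
pose phi y : rat := (mn y).1%:~R / (mn y).2%:~R.
(* The fraction does not depend on the chosen relation, because [g] is independent. *)
have phiE y (m n : int) : n != 0 -> y *~ n = g *~ m -> phi y = m%:~R / n%:~R.
  move=> n0 yn; have [n'0 yn'] := mnP y.
  have : g *~ ((mn y).1 * n) = g *~ (m * (mn y).2).
    by rewrite !mulrzA -yn -yn' -!mulrzA mulrC.
  move/eqP; rewrite -subr_eq0 -mulrzBr => /eqP/gind/eqP; rewrite subr_eq0 => /eqP eqmn.
  apply/eqP; rewrite /phi eqr_div ?intr_eq0 // -!intrM eqmn //.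
exists phi => [x y|].
  have [n0 xn] := mnP x; have [n'0 yn] := mnP y.
  rewrite (phiE _ ((mn x).1 * (mn y).2 + (mn y).1 * (mn x).2) ((mn x).2 * (mn y).2)).
  - by rewrite /phi addf_div ?intr_eq0 // !intrD !intrM.
  - by rewrite mulf_neq0.
  - rewrite mulrzDl mulrzDr mulrzA xn (mulrC (mn x).2) (mulrzA y) yn.
    by rewrite -!mulrzA.
move=> x y phixy; have [n0 xn] := mnP x; have [n'0 yn] := mnP y.
apply/eqP; rewrite -subr_eq0; apply/eqP.
apply: (@torsion_freeMz _ _ ((mn x).2 * (mn y).2)) => //; first by rewrite mulf_neq0.
have : (mn x).1 * (mn y).2 = (mn y).1 * (mn x).2.
  apply/eqP; rewrite -(eqr_int rat) !intrM -eqr_div ?intr_eq0 //.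
  exact/eqP.
move=> eqmn; rewrite mulrzBl mulrzA xn (mulrC (mn x).2) (mulrzA y) yn -!mulrzA eqmn.
by rewrite subrr.
Qed.

Lemma rank_one_puiseux (M : nmodType) (G : zmodType) (i : {additive M -> G}) :
    is_quotient_group i -> torsion_free G -> has_rank G 1 ->
    [set: M] <> invertibles [set: M] ->
  exists2 H : set rat, puiseux_monoid H & isomorphic [set: M] H.
Proof.
move=> [inj_i _] tfG rkG nonunit.
have [phi phiD phi_inj] := rank_one_embedding tfG rkG.
have phi0 : phi 0 = 0 by apply: (addIr (phi 0)); rewrite -phiD add0r add0r.
have [a ainv] : exists a : M, forall b, a + b <> 0.
  apply/not_existsP => ainv; apply: nonunit; apply/seteqP; split=> // x _.
  split=> //; have /existsNP[b /contrapT xb] := ainv x.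
  by exists b.
(* The sign makes the image of the noninvertible [a] positive; noninvertibility then forces all
   other values to be nonnegative. *)
pose f x := Num.sg (phi (i a)) * phi (i x).
have fD x y : f (x + y) = f x + f y by rewrite /f raddfD phiD mulrDr.
have a0 : phi (i a) != 0.
  apply/eqP; rewrite -phi0 -[0 in RHS](raddf0 i) => /phi_inj/inj_i a0.
  by apply: (ainv 0); rewrite addr0.
have f_inj : injective f.
  by move=> x y /mulfI; rewrite sgr_eq0 => /(_ a0)/phi_inj/inj_i.
have f0 : f 0 = 0 by rewrite /f raddf0 phi0 mulr0.
have fMn x n : f (x *+ n) = f x *+ n.
  by elim: n => [|n IHn]; rewrite ?mulr0n // !mulrS fD IHn.
have fa_gt0 : 0 < f a by rewrite /f -normrEsg normr_gt0.
have f_ge0 x : 0 <= f x.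
  (* If [f x < 0 < f a], some [p a + q x] with [p, q > 0] vanishes. *)
  rewrite leNgt; apply/negP => fx_lt0.
  have [q q_gt0 faE] : exists2 q, 0 < q & f a = q * - f x.
    exists (f a / - f x); first by rewrite divr_gt0 // oppr_gt0.
    by rewrite divfK // oppr_eq0 lt_eqF.
  have [m [n [m_gt0 n_gt0 mnE]]] :
      exists m n : nat, [/\ (0 < m)%N, (0 < n)%N & f a *+ n = - f x *+ m].
    exists `|numq q|%N, `|denq q|%N; split.
    - by rewrite absz_gt0 numq_eq0 gt_eqF.
    - by rewrite absz_gt0 denq_neq0.
    have qE : q * `|denq q|%N%:R = `|numq q|%N%:R.
      have num0 : 0 <= numq q by rewrite numq_ge0 ltW.
      rewrite !natr_absz !ger0_norm //.
      by rewrite -[X in X * _]divq_num_den divfK // intr_eq0 denq_neq0.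
    by rewrite faE -[LHS]mulr_natr -[RHS]mulr_natr -qE; lra.
  case: n n_gt0 mnE => // n _ mnE.
  apply: (ainv (a *+ n + x *+ m)); apply: f_inj.
  by rewrite addrA -mulrS fD !fMn f0 mnE mulNrn addNr.
exists (range f).
  apply/puiseux_monoidP; split; first by exists 0.
    by move=> _ _ [x _ <-] [y _ <-]; exists (x + y).
  by move=> _ [x _ <-].
exists f; split=> //; split=> [x _|x y _ _ /f_inj //|//].
by exists x.
Qed.

(** * Multisets, distances of factorizations and exchange of atoms *)

Section Multisets.
Local Open Scope mset_scope.
Context {K : choiceType}.
Implicit Types (A B : {mset K}) (s t : seq K).

Lemma perm_msetD A B : perm_eq (msetD A B) (A ++ B).
Proof. by apply/allP => x _ /=; rewrite count_cat !count_mem_mset msetE2. Qed.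

Lemma size_msetD A B :
  size (msetD A B) = (size A + size B)%N.
Proof. by rewrite (perm_size (perm_msetD A B)) size_cat. Qed.

Lemma size_seq_mset s : size (seq_mset s) = size s.
Proof. exact/perm_size/perm_eq_seq_mset. Qed.

Lemma seq_mset_cat s t :
  seq_mset (s ++ t) = msetD (seq_mset s) (seq_mset t).
Proof. by apply/msetP => x; rewrite msetE2 !mset_seqE count_cat. Qed.

Lemma size_msetB A B :
  (size (msetB A B) <= size A)%N.
Proof.
have /msetBDKC {2}<- := msubsetDl A B; rewrite size_msetD; exact: leq_addr.
Qed.

End Multisets.

(** The common part [w] cancels, and removing what [s] and [t] still share only shrinks both
    sides. *)
Lemma distance_cat (s t w : seq rat) :
  (distance (seq_mset (s ++ w)) (seq_mset (t ++ w)) <= maxn (size s) (size t))%N.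
Proof.
rewrite /distance !seq_mset_cat -msetDIl !msetBDr.
by rewrite geq_max !leq_max -[size s]size_seq_mset -[size t]size_seq_mset
  !size_msetB orbT.
Qed.

Lemma sum_nseq (V : nmodType) (x : V) n : \sum_(y <- nseq n x) y = x *+ n.
Proof. by rewrite big_nseq; elim: n => [|n IHn]; rewrite ?mulr0n // mulrS /= IHn. Qed.

Lemma sum_msetB_msetI (A B : {mset rat}%mset) :
    \sum_(x <- A) x = \sum_(x <- B) x ->
  \sum_(x <- msetB A (msetI A B)) x = \sum_(x <- msetB B (msetI A B)) x.
Proof.
have sumB C D : (msubset D C)%mset ->
    \sum_(x <- C) x = \sum_(x <- D) x + \sum_(x <- msetB C D) x :> rat.
  by move=> /msetBDKC {1}<-; rewrite (perm_big _ (perm_msetD _ _)) big_cat.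
rewrite (sumB A _ (msubsetIl A B)) (sumB B _ (msubsetIr A B)).
exact: addrI.
Qed.

(** Sequences instead of multisets, so that prefixes and concatenations are at hand; [seq_mset]
    leads back to [factorizations]. *)
Definition factorization_le (H : set rat) (L : nat) (a : rat) :=
  exists s : seq rat, [/\ forall u, u \in s -> atoms H u,
                          \sum_(u <- s) u = a & (size s <= L)%N].

Lemma factorizations_seq (H : set rat) (s : seq rat) :
  (forall u, u \in s -> atoms H u) ->
  factorizations H (\sum_(u <- s) u) (seq_mset s).
Proof.
move=> sat; have ps := perm_eq_seq_mset s; split; last exact: perm_big.
by move=> u; rewrite (perm_mem ps); apply: sat.
Qed.

Lemma factorization_leD (H : set rat) (m n : nat) (a b : rat) :
  factorization_le H m a -> factorization_le H n b ->
  factorization_le H (m + n) (a + b).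
Proof.
move=> [s [sat <- sm]] [t [tat <- tn]]; exists (s ++ t); split.
- by move=> u; rewrite mem_cat => /orP[/sat|/tat].
- by rewrite big_cat.
- by rewrite size_cat leq_add.
Qed.

Lemma factorization_leW (H : set rat) (m n : nat) (a : rat) : (m <= n)%N ->
  factorization_le H m a -> factorization_le H n a.
Proof. by move=> mn [s [sat sa sm]]; exists s; split=> //; apply: leq_trans mn. Qed.

Lemma factorization_le_atom (H : set rat) (u : rat) : atoms H u ->
  factorization_le H 1 u.
Proof.
by move=> uat; exists [:: u]; split; rewrite ?big_seq1 // => v; rewrite inE => /eqP->.
Qed.

Lemma factorization_le_nseq (H : set rat) (u : rat) (n : nat) : atoms H u ->
  factorization_le H n (u *+ n).
Proof.
move=> uat; exists (nseq n u); split; rewrite ?size_nseq ?sum_nseq //.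
by move=> v; rewrite mem_nseq => /andP[_ /eqP->].
Qed.

Lemma tame_bound_replace (H : set rat) (u : rat) (n L : nat) :
    puiseux_monoid H -> atoms H u ->
    (forall s : seq rat, (forall v, v \in s -> atoms H v) -> (size s <= n)%N ->
       size s = n \/ H (\sum_(v <- s) v - u) ->
       factorization_le H L (\sum_(v <- s) v - u)) ->
  tame_bound H u (maxn n L.+1).
Proof.
move=> pmH uat short a Ha [z1 [z1at z1a] uz1] z [zat za].
have [|||t [tat ta tL]] := short (take n z).
- by move=> v /mem_take/zat.
- by rewrite size_take; case: ltnP.
- have [nz|zn] := leqP n (size z); first by left; rewrite size_takel.
  right; rewrite take_oversize 1?ltnW // za -z1a (perm_big _ (perm_to_rem uz1)).
  rewrite big_cons addrC addKr; apply: pm_sum => // v /mem_rem/z1at.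
  by case.
have zE : z = seq_mset (take n z ++ drop n z) by rewrite cat_take_drop seq_mset_id.
exists (seq_mset ((u :: t) ++ drop n z)); split.
- have <- : \sum_(v <- (u :: t) ++ drop n z) v = a.
    rewrite big_cat big_cons ta /= -za -[in RHS](cat_take_drop n z) big_cat /=.
    lra.
  apply: factorizations_seq => v; rewrite mem_cat inE => /orP[/orP[/eqP->|/tat]|] //.
  by move=> /mem_drop/zat.
- by rewrite (perm_mem (perm_eq_seq_mset _)) inE eqxx.
- rewrite [X in distance X _]zE (leq_trans (distance_cat _ _ _)) //.
  rewrite geq_max !leq_max /= ltnS tL orbT andbT; apply/orP; left.
  by rewrite size_take; case: ltnP.
Qed.

(** * Criteria for finite [Lambda], local tameness and global tameness *)

Section Tame.
Variable R : realType.
Implicit Types (H : set rat) (L N : nat).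

Lemma Lambda_lty H L : (forall a, H a -> factorization_le H L a) ->
  (Lambda H R < +oo)%E.
Proof.
move=> short; apply: (@le_lt_trans _ _ L%:R%:E); last exact: ltry.
apply/ereal_supP => _ [a Ha <-]; have [s [sat sa sL]] := short a Ha.
apply: (@le_trans _ _ (size s)%:R%:E); last by rewrite lee_fin ler_nat.
apply: ereal_inf_lbound; exists (size s) => //; exists (seq_mset s).
  by rewrite -sa; apply: factorizations_seq.
exact: size_seq_mset.
Qed.

Lemma tame_degree_le H (u : rat) N : tame_bound H u N ->
  (tame_degree H R u <= N%:R%:E)%E.
Proof. by move=> uN; apply: ereal_inf_lbound; exists N. Qed.

Lemma globally_tameI H N : (forall u, atoms H u -> tame_bound H u N) ->
  globally_tame H R.
Proof.
move=> uN; apply: (@le_lt_trans _ _ N%:R%:E); last exact: ltry.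
by apply/ereal_supP => _ [u /uN/tame_degree_le ? <-].
Qed.

Lemma not_globally_tameI H :
    (forall k : nat, exists2 u, atoms H u &
       forall N, tame_bound H u N -> (k <= N)%N) ->
  ~ globally_tame H R.
Proof.
move=> unb; rewrite /globally_tame; set S := ereal_sup _ => S_lty.
have S_ge k : (k%:R%:E <= S)%E.
  have [u uat uk] := unb k; apply: le_ereal_sup_tmp.
  exists (tame_degree H R u); first by exists u.
  by apply/le_ereal_inf_tmp => _ [N /uk kN <-]; rewrite lee_fin ler_nat.
(* The supremum is at least every natural number: a real value is beaten by its truncation plus one,
   and [-oo] by zero. *)
case: S S_lty S_ge => [r _ /(_ (Num.truncn r).+1)|//|_ /(_ 0%N)//].
by rewrite lee_fin leNgt truncnS_gt.
Qed.

Lemma strongly_primary_locally_tame H L : strongly_primary_puiseux H ->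
  (forall a, H a -> factorization_le H L a) -> locally_tame H R.
Proof.
move=> [pmH [_ spH]] short u uat.
have [Hu u0 _] := uat.
have [|n _ nP] := spH u; first exact/noninvertibles_puiseux.
apply: (@le_lt_trans _ _ (maxn n L.+1)%:R%:E); last exact: ltry.
apply: tame_degree_le; apply: tame_bound_replace => // s sat _ [sn|]; last exact: short.
apply: short; rewrite (big_nth 0) sn big_mkord.
have [|h Hh <-] := nP (fun i => s`_i); last by rewrite [_ - u]addrAC subrr add0r.
by move=> i; apply/noninvertibles_puiseux => //; case: (sat s`_i); rewrite // mem_nth ?sn.
Qed.

End Tame.

(** * Comparing the real numbers with power sets of countable types *)

Lemma injective_card_le (T U : Type) (f : T -> U) :
  injective f -> [set: T] #<= [set: U].
Proof.
move=> f_inj; have := card_leT (range f); rewrite (card_le_eql (inj_card_eq _)) //.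
by move=> x y _ _; apply: f_inj.
Qed.

Section Ternary.
Variable R : realType.
Implicit Types (b c : nat -> bool) (n m : nat).

(** Base-three expansions with digits 0 and 1. A first difference at digit [n] is decisive, since
    all later digits together contribute at most half of [3^-n]. *)
Let ternary_sum b n : R := \sum_(i < n) (b i)%:R * (3^-1) ^+ i.

Let ternary_sumS b n :
  ternary_sum b n.+1 = ternary_sum b n + (b n)%:R * (3^-1) ^+ n.
Proof. by rewrite /ternary_sum big_ord_recr. Qed.

(** The last two terms are the full geometric sum of [3^-i] over [n <= i < n + m], the case of all
    digits equal to 1. *)
Let ternary_sum_le b n m : ternary_sum b (n + m) <=
  ternary_sum b n + 3 / 2 * (3^-1) ^+ n - 3 / 2 * (3^-1) ^+ (n + m).
Proof.
elim: m => [|m IHm]; first by rewrite addn0; lra.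
rewrite addnS ternary_sumS exprS.
have : 0 <= (3^-1 : R) ^+ (n + m) by rewrite exprn_ge0 // invr_ge0.
move: IHm; set t := _ ^+ (n + m); set u := _ ^+ n.
by case: (b _); rewrite ?mul1r ?mul0r; lra.
Qed.

Let ternary_sum_mono b n m : ternary_sum b n <= ternary_sum b (n + m).
Proof.
elim: m => [|m IHm]; first by rewrite addn0.
by rewrite addnS ternary_sumS (le_trans IHm) // lerDl mulr_ge0 // exprn_ge0 // invr_ge0.
Qed.

Let ternary b : R := sup (range (ternary_sum b)).

Let ternary_le b n : ternary b <= ternary_sum b n + 3 / 2 * (3^-1) ^+ n.
Proof.
apply: ge_sup; first by exists (ternary_sum b 0), 0%N.
move=> _ [m _ <-]; have := ternary_sum_le b n m; have := ternary_sum_mono b m n.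
rewrite [(m + n)%N]addnC.
have : 0 <= (3^-1 : R) ^+ (n + m) by rewrite exprn_ge0 // invr_ge0.
by lra.
Qed.

Let ternary_ge b n : ternary_sum b n <= ternary b.
Proof.
apply: ub_le_sup; last by exists n.
exists (3 / 2) => _ [m _ <-]; have := ternary_sum_le b 0 m.
have : 0 <= (3^-1 : R) ^+ (0 + m) by rewrite exprn_ge0 // invr_ge0.
by rewrite /ternary_sum big_ord0 expr0; lra.
Qed.

Let ternary_lt b c n : (forall i, (i < n)%N -> b i = c i) -> b n -> ~~ c n ->
  ternary c < ternary b.
Proof.
move=> eqbc bn /negbTE cn; apply: le_lt_trans (ternary_le c n.+1) _.
apply: lt_le_trans (ternary_ge b n.+1).
rewrite !ternary_sumS bn cn exprS mul1r mul0r.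
have -> : ternary_sum b n = ternary_sum c n.
  by apply: eq_bigr => i _; rewrite eqbc.
have : 0 < (3^-1 : R) ^+ n by rewrite exprn_gt0 // invr_gt0.
by lra.
Qed.

Let ternary_inj : injective ternary.
Proof.
move=> b c eqbc; apply/funext => n0; apply: contrapT => /eqP bc.
have [n bcn nmin] := ex_minnP (ex_intro (fun n => b n != c n) n0 bc).
have eq_lt i : (i < n)%N -> b i = c i.
  by rewrite ltnNge => /negP ni; apply/eqP; apply: contra_notT ni; apply: nmin.
case bn: (b n) in bcn; case cn: (c n) in bcn => //.
  by have := ternary_lt eq_lt bn (negbT cn); rewrite eqbc ltxx.
have := @ternary_lt c b n (fun i ni => esym (eq_lt i ni)) cn (negbT bn).
by rewrite eqbc ltxx.
Qed.

Lemma card_set_le_real (T : countType) : [set: set T] #<= [set: R].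
Proof.
pose code (A : set T) n := `[< exists2 x, A x & choice.pickle x = n >].
have sub A B : code A = code B -> A `<=` B.
  move=> eqAB x Ax; have : code A (choice.pickle x) by apply/asboolP; exists x.
  by rewrite eqAB => /asboolP[y By /(pcan_inj choice.pickleK) <-].
apply: (@injective_card_le _ _ (ternary \o code)) => A B /ternary_inj eqAB.
by apply/seteqP; split; apply: sub.
Qed.

End Ternary.

(** As in a Dedekind cut, a real number is determined by the codes of the rationals below it. *)
Lemma card_real_le_set (R : realType) : [set: R] #<= [set: set nat].
Proof.
apply: (@injective_card_le _ _
  (fun r : R => [set n | exists2 q : rat, ratr q < r & choice.pickle q = n])).
move=> x y; wlog lt_xy : x y / x < y => [hwlog eqxy|].
  by case: (ltgtP x y) => // lt_xy; [|apply: esym]; apply: hwlog.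
have [q] := rat_in_itvoo lt_xy; rewrite in_itv /= => /andP[xq qy] eqxy.
have : [set n | exists2 q : rat, ratr q < y & choice.pickle q = n] (choice.pickle q).
  by exists q.
rewrite -eqxy => -[r rx /(pcan_inj choice.pickleK) rq].
by move: rx; rewrite rq ltNge (ltW xq).
Qed.

(** * Isomorphisms of Puiseux monoids as multiplications *)

Lemma isomorphic_quot (H K : set rat) : puiseux_monoid H -> isomorphic H K ->
  exists l : rat, (forall x, quot H x -> quot K (l * x)) /\
    (forall y, quot K y -> exists2 x, quot H x & y = l * x).
Proof.
move=> pmH [f [f0 fD [fK f_inj f_surj]]].
have {}fD x y : H x -> H y -> f (x + y) = f x + f y.
  by move=> Hx Hy; apply: fD; rewrite inE.
have fMn x n : H x -> f (x *+ n) = f x *+ n.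
  move=> Hx; elim: n => [|n IHn]; first by rewrite !mulr0n.
  by rewrite !mulrS fD ?IHn //; apply: pmMn.
(* A nonzero [a] and any [x] in [H] satisfy [a *+ p = x *+ q] with [q != 0], so additivity forces
   [f x = (f a / a) * x]. *)
suff [l fE] : exists l : rat, forall x, H x -> f x = l * x.
  exists l; split=> [_ [a [b [Ha Hb ->]]]|
                     _ [_ [_ [/f_surj[a Ha <-] /f_surj[b Hb <-] ->]]]].
    by exists (f a), (f b); rewrite mulrBr !fE //; split=> //; rewrite -fE //; apply: fK.
  by exists (a - b); [exists a, b|rewrite mulrBr !fE].
have [[a Ha a0]|triv] := pselect (exists2 a, H a & a <> 0); last first.
  exists 0 => x Hx; rewrite mul0r; have -> // : x = 0.
  by apply: contrapT => x0; apply: triv; exists x.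
exists (f a / a) => x Hx.
pose p := (`|numq x| * `|denq a|)%N; pose q := (`|numq a| * `|denq x|)%N.
have natE y : H y -> y * `|denq y|%N%:R = `|numq y|%N%:R.
  move=> Hy; rewrite !natr_absz !ger0_norm ?denq_ge0 ?numq_ge0 ?(pm_ge0 pmH) //.
  by rewrite -[X in X * _]divq_num_den divfK // intr_eq0 denq_neq0.
have pq : a *+ p = x *+ q.
  rewrite -[LHS]mulr_natr -[RHS]mulr_natr !natrM mulrCA natE //.
  by rewrite [RHS]mulrCA natE // mulrC.
have q0 : q%:R != 0 :> rat.
  rewrite pnatr_eq0 muln_eq0 !absz_eq0 numq_eq0 (negbTE (denq_neq0 x)) orbF.
  exact/eqP.
have fpq : f a * p%:R = f x * q%:R by rewrite !mulr_natr -!fMn // pq.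
have {}pq : a * p%:R = x * q%:R by rewrite !mulr_natr.
apply: (mulIf q0); rewrite -fpq -[RHS]mulrA -pq mulrA divfK //; exact/eqP.
Qed.

(** * Localizations of [Z], sets of primes and the number of isomorphism classes *)

Section Localization.
Implicit Types S T : nat_pred.

(** This is [Z] with the primes in [S] inverted. *)
Definition localization S : set rat :=
  [set x | exists2 n : nat, S.-nat n & x * n%:R \is a Num.int].

Lemma localization_zmod_closed S : GRing.zmod_closed [in localization S].
Proof.
split=> [|x y]; rewrite !inE; first by exists 1%N; rewrite ?mul0r.
move=> [m Sm mx] [n Sn ny]; exists (m * n)%N; first by rewrite pnatM Sm.
rewrite mulrBl natrM mulrA (mulrC m%:R) mulrA.
by rewrite rpredB // rpredM // natr_int.
Qed.

Lemma localization_div S (p : nat) x : prime p -> p \in S -> localization S x ->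
  localization S (x / p%:R).
Proof.
move=> p_pr Sp [n Sn nx]; exists (p * n)%N; first by rewrite pnatM pnatE ?Sp.
by rewrite natrM mulrA divfK // pnatr_eq0 -lt0n prime_gt0.
Qed.

Lemma localization1 S : localization S 1.
Proof. by exists 1%N; rewrite ?mul1r // natr_int. Qed.

(** If [n / p] is an integer, then [p] divides [n], whose prime factors all lie in [S]. *)
Lemma localizationV S (p : nat) : prime p -> localization S (p%:R^-1) -> p \in S.
Proof.
move=> p_pr [n Sn /intrP[k kE]].
have p0 : p%:R != 0 :> rat by rewrite pnatr_eq0 -lt0n prime_gt0.
have nE : n%:Z = k * p%:Z.
  by apply/eqP; rewrite -(eqr_int rat) intrM -kE -!pmulrn mulrAC mulVf // mul1r.
have pn : (p %| n)%N by have : (p %| n%:Z)%Z by rewrite nE dvdz_mull.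
by rewrite -pnatE // (pnat_dvd pn).
Qed.

(** Writing [1 = l * x] turns the quotient [x / p] in the first localization into [1 / p] in the
    second. *)
Lemma localization_scale S T (l : rat) p : prime p -> p \in S ->
    (forall x, localization S x -> localization T (l * x)) ->
    (forall y, localization T y -> exists2 x, localization S x & y = l * x) ->
  p \in T.
Proof.
move=> p_pr Sp ST TS; have [x Sx lx] := TS 1 (localization1 T).
apply: localizationV => //; have -> : p%:R^-1 = l * (x / p%:R) by rewrite mulrA -lx mul1r.
exact/ST/localization_div.
Qed.

End Localization.


(** A strictly increasing sequence of odd primes; it need not exhaust them. *)
Fixpoint odd_prime_above (n : nat) : nat :=
  s2val (prime_above (if n is m.+1 then odd_prime_above m else 2)).

Lemma odd_prime_aboveP n :
  ((if n is m.+1 then odd_prime_above m else 2) < odd_prime_above n)%N /\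
  prime (odd_prime_above n).
Proof. by case: n => [|n] /=; case: prime_above. Qed.

Lemma odd_prime_above_inj : injective odd_prime_above.
Proof.
apply: incn_inj; apply: leq_mono; apply: homo_ltn => [n m p|n]; first exact: ltn_trans.
by case: (odd_prime_aboveP n.+1).
Qed.

Lemma odd_prime_above_gt2 n : (2 < odd_prime_above n)%N.
Proof.
elim: n => [|n IHn]; first by case: (odd_prime_aboveP 0).
by apply: ltn_trans IHn _; case: (odd_prime_aboveP n.+1).
Qed.

(** The odd primes encode [A]. The prime 2 is always present, so that the resulting valuation
    monoids are 2-divisible and not isomorphic to [N_0]. *)
Definition primes_of (A : set nat) : nat_pred :=
  [pred p | `[< p = 2%N \/ exists2 n, A n & p = odd_prime_above n >]].

Lemma primes_of2 (A : set nat) : 2%N \in primes_of A.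
Proof. by rewrite inE; left. Qed.

Lemma primes_of_odd (A : set nat) n : odd_prime_above n \in primes_of A <-> A n.
Proof.
rewrite inE; split=> [[n2|[m Am /odd_prime_above_inj->//]]|An].
  by have := odd_prime_above_gt2 n; rewrite n2.
by right; exists n.
Qed.

(* The element [f 1] would be divisible by every power of 2 in [N_0]. *)
Lemma two_divisible_not_nat (V : set rat) :
    puiseux_monoid V -> V 1 -> (forall x, V x -> V (x / 2)) ->
  ~ isomorphic V [set: nat].
Proof.
move=> pmV V1 Vdiv [f [f0 fD [_ f_inj _]]].
have Vpow k : V (2^-1 ^+ k).
  by elim: k => [|k IHk]; rewrite ?expr0 // exprS mulrC; apply: Vdiv.
have f1E k : f 1 = (2 ^ k * f (2^-1 ^+ k))%N.
  elim: k => [|k IHk]; first by rewrite mul1n.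
  have half : (2^-1 : rat) ^+ k = 2^-1 ^+ k.+1 + 2^-1 ^+ k.+1 by rewrite exprS; lra.
  rewrite IHk half fD ?inE // expnS; set t := f _.
  by rewrite -[t + t]/(t + t)%N addnn -mul2n mulnCA mulnA.
have f1 : f 1 <> 0%N.
  move=> f1; suff /eqP : (1 : rat) = 0 by [].
  by apply: f_inj; rewrite ?inE ?f1 ?f0 //; apply: pm0.
have := ltn_expl (f 1) (isT : (1 < 2)%N); rewrite ltnNge => /negP; apply.
apply: dvdn_leq; first by rewrite lt0n; apply/eqP.
by rewrite [in X in (_ %| X)%N](f1E (f 1)) dvdn_mulr.
Qed.

(** Classes are images of subsets of the countable set of rationals, which bounds their number from
    above. From below, each set [A] of naturals yields a monoid in [P] whose quotient group is the
    localization coding [A]. *)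
Lemma card_iso_classes (R : realType) (P : set (set rat)) :
    P `<=` puiseux_monoid ->
    (forall V, puiseux_valuation_monoid V -> V <> [set 0] ->
       ~ isomorphic V [set: nat] -> exists2 H, P H & quot H = quot V) ->
  iso_classes P #= [set: R].
Proof.
move=> Ppm Pex; rewrite card_eq_le; apply/andP; split.
  apply: card_le_trans (card_image_le _ _) _.
  exact: card_le_trans (card_leT _) (card_set_le_real _ _).
apply: card_le_trans (card_real_le_set _) _.
pose V A : set rat := [set x | localization (primes_of A) x /\ 0 <= x].
have /choice[F FP] A : exists H, P H /\ quot H = localization (primes_of A).
  have [pvV quotV] := nonneg_valuation_monoid (localization_zmod_closed (primes_of A)).
  have V1 : V A 1 by split; first exact: localization1.
  have [|||H PH quotH] := Pex (V A); rewrite ?quotV //.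
  - by move=> V0; have : [set 0] (1 : rat) by rewrite -V0.
  - apply: two_divisible_not_nat => //; first by case: pvV.
    move=> x [Sx x0]; split; last by lra.
    by apply: localization_div => //; apply: primes_of2.
  - by exists H; split; rewrite ?quotH.
(* An isomorphism multiplies one localization onto the other by a rational, and so transports the
   inverted primes. *)
have F_iso A B : isomorphic (F A) (F B) -> A `<=` B.
  move=> isoAB n An; have [PA quotA] := FP A; have [PB quotB] := FP B.
  have [l []] := isomorphic_quot (Ppm _ PA) isoAB; rewrite quotA quotB => AB BA.
  apply/primes_of_odd; apply: localization_scale AB BA.
    by case: (odd_prime_aboveP n).
  exact/primes_of_odd.
have class_refl A : puiseux_iso_class (F A) (F A).
  split; first by apply: Ppm; case: (FP A).
  by exists idfun; split=> //; split=> // [x y _ _ //|x Fx]; exists x.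
apply: (@card_le_trans _ _ _ ((puiseux_iso_class \o F) @` setT)); last first.
  by apply: subset_card_le => _ [A _ <-]; exists (F A) => //; case: (FP A).
rewrite (card_le_eqr (inj_card_eq _)) ?card_lexx //.
move=> A B _ _ /= eqAB; apply/seteqP; split; apply: F_iso.
  by have := class_refl B; rewrite -eqAB => -[].
by have := class_refl A; rewrite eqAB => -[].
Qed.

(** * Complete integral closures inside a valuation monoid *)

Lemma archimedean_mulrn (v c : rat) : 0 < v -> exists n, c <= v *+ n.
Proof.
move=> v0; exists (Num.truncn (c / v)).+1.
by rewrite -mulr_natl -ler_pdivrMr // ltW // truncnS_gt.
Qed.

Lemma complete_integral_closure_ge0 (H : set rat) x : puiseux_monoid H ->
  complete_integral_closure H x -> 0 <= x.
Proof.
move=> pmH [_ [c Hc cx]]; rewrite leNgt; apply/negP => x0.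
have [|n nP] := @archimedean_mulrn (- x) c; first by lra.
(* One multiple beyond [n] keeps the index positive and makes [c + x *+ n.+1] strictly negative. *)
by have := pm_ge0 pmH (cx n.+1 isT); rewrite mulrS -[x *+ n]opprK -mulNrn; lra.
Qed.

Lemma complete_integral_closure_valuation (V H : set rat) :
    puiseux_valuation_monoid V -> puiseux_monoid H -> H `<=` V ->
    (forall x, V x -> exists2 c, H c & forall n, H (c + x *+ n)) ->
  complete_integral_closure H = V.
Proof.
move=> pvV pmH HV Vc; apply/seteqP; split=> [x Hx|x /Vc[c Hc cx]].
  apply/valuation_monoid_quot => //; split; last exact: complete_integral_closure_ge0 Hx.
  by case: Hx => -[a [b [/HV ? /HV ? ->]]] _; exists a, b.
split; last by exists c.
(* The case [n = 1] exhibits [x] as a difference of elements of [H]. *)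
by exists (c + x *+ 1), c; split=> //; lra.
Qed.

Lemma quot_complete_integral_closure (V H : set rat) :
  puiseux_monoid H -> H `<=` V -> complete_integral_closure H = V ->
  quot H = quot V.
Proof.
move=> pmH HV cicH; apply/seteqP; split=> x [a [b [Ha Hb ->]]].
  by exists a, b; split=> //; apply: HV.
by apply: quotB => //; [move: Ha|move: Hb]; rewrite -cicH => -[].
Qed.

(** * Truncated valuation monoids: nonempty conductor and global tameness *)

Section ValuationCut.
Variables (V : set rat) (v : rat).
Hypotheses (pvV : puiseux_valuation_monoid V) (Vv : V v) (v_gt0 : 0 < v).

Definition valuation_cut : set rat := [set x | x = 0 \/ (V x /\ v <= x)].
Local Notation H := valuation_cut.

Let pmV : puiseux_monoid V. Proof. by case: pvV. Qed.

Lemma valuation_cut_sub : H `<=` V.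
Proof. by move=> x [->|[]//]; apply: pm0. Qed.

Lemma valuation_cut_ge x : H x -> x <> 0 -> v <= x.
Proof. by case=> [->//|[]]. Qed.

Lemma valuation_cutB x y : V x -> V y -> v <= x - y -> H (x - y).
Proof.
move=> Vx Vy vxy; right; split=> //; apply/valuation_monoid_quot => //.
by split; [exists x, y|have := v_gt0; lra].
Qed.

Lemma valuation_cut_puiseux : puiseux_monoid H.
Proof.
apply/puiseux_monoidP; split=> [|x y Hx Hy|x /valuation_cut_sub/(pm_ge0 pmV)//].
  by left.
have [->|/eqP x0] := eqVneq x 0; first by rewrite add0r.
have := valuation_cut_ge Hx x0; have := pm_ge0 pmV (valuation_cut_sub Hy).
right; split; last by lra.
by apply: pmD => //; apply: valuation_cut_sub.
Qed.

Lemma valuation_cut_strongly_primary : strongly_primary_puiseux H.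
Proof.
apply: strongly_primary_puiseuxI; first exact: valuation_cut_puiseux.
  by exists v; [right|move/eqP; rewrite gt_eqF].
(* With [n v >= a + v], a sum of [n] nonzero elements exceeds [a] by at least [v], as membership in
   [H] demands. *)
move=> a Ha _; have [n nP] := archimedean_mulrn (a + v) v_gt0.
exists n => x xP; apply: valuation_cutB; last 2 first.
- exact: valuation_cut_sub.
- have : v *+ n <= \sum_i x i.
    rewrite -[n in v *+ n]card_ord -sumr_const; apply: ler_sum => i _.
    by apply: valuation_cut_ge; case: (xP i).
  by rewrite lerBrDr addrC; apply: le_trans.
elim/big_ind: _ => [||i _]; [exact: pm0|exact: pmD|].
by apply: valuation_cut_sub; case: (xP i).
Qed.

Lemma valuation_cut_closure : complete_integral_closure H = V.
Proof.
apply: complete_integral_closure_valuation => //.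
- exact: valuation_cut_puiseux.
- exact: valuation_cut_sub.
move=> x Vx; exists v => [|n]; right; split=> //; first exact/pmD/pmMn.
by rewrite lerDl mulrn_wge0 // (pm_ge0 pmV).
Qed.

Lemma valuation_cut_conductor : conductor H (complete_integral_closure H) v.
Proof.
rewrite valuation_cut_closure; split.
  by apply: pm_quot; [exact: valuation_cut_puiseux|right].
move=> _ [x Vx <-]; right; split; first exact: pmD.
by rewrite lerDl (pm_ge0 pmV).
Qed.

Lemma valuation_cut_atom x : V x -> v <= x < v *+ 2 -> atoms H x.
Proof.
move=> Vx /andP[vx xv]; have v0 := v_gt0; split; [by right|by lra|].
by move=> a b Ha Hb /(valuation_cut_ge Ha) ? /(valuation_cut_ge Hb) ?; lra.
Qed.

Lemma valuation_cut_atom_lt u : atoms H u -> v <= u < v *+ 2.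
Proof.
have v0 := v_gt0; move=> [Hu u0 uat].
rewrite valuation_cut_ge //= ltNge; apply/negP => vu.
(* From [2 v] on, [v] splits off. *)
apply: (uat v (u - v)); [by right| |lra|lra|lra].
by apply: valuation_cutB => //; [exact: valuation_cut_sub|lra].
Qed.

(** Copies of the atom [v] are split off while at least [2 v] is left; what remains below [2 v] is
    zero or an atom. *)
Lemma valuation_cut_factorization m x : H x -> x < v *+ m.+1 ->
  factorization_le H m x.
Proof.
have v0 := v_gt0; elim: m x => [|m IHm] x Hx xv.
  exists [::]; rewrite big_nil; split=> //; apply: contrapT => x0.
  by have := valuation_cut_ge Hx (x0 \o esym); lra.
have [vx|vx] := leP (v *+ 2) x; last first.
  have [->|/eqP x0] := eqVneq x 0; first by exists [::]; rewrite big_nil.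
  apply: (@factorization_leW _ 1) => //; apply: factorization_le_atom.
  by apply: valuation_cut_atom; [exact: valuation_cut_sub|rewrite vx valuation_cut_ge].
rewrite -[x](subrKC v) -(add1n m); apply: factorization_leD.
  by apply/factorization_le_atom/valuation_cut_atom => //; lra.
apply: IHm; first by apply: valuation_cutB => //; [exact: valuation_cut_sub|lra].
by move: xv; rewrite mulrS; lra.
Qed.

(* Three atoms weigh at least [3 v], while an atom weighs less than [2 v]. *)
Lemma valuation_cut_tame_bound u : atoms H u -> tame_bound H u 6.
Proof.
have v0 := v_gt0; move=> uat; have /andP[vu uv] := valuation_cut_atom_lt uat.
(* Three atoms sum to at most [6 v]; after subtracting [u >= v] the rest lies below [6 v] and needs
   at most 5 atoms. *)
apply: (@tame_bound_replace H u 3 5) => //; first exact: valuation_cut_puiseux.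
move=> s sat s3 s_u.
have sum_bounds : v *+ size s <= \sum_(x <- s) x <= v *+ 2 *+ size s.
  clear s3 s_u; elim: s sat => [|x s IHs] sat; first by rewrite big_nil !mulr0n lexx.
  have /andP[vx xv] := valuation_cut_atom_lt (sat x (mem_head _ _)).
  have /IHs/andP[vs sv] y : y \in s -> atoms H y.
    by move=> ys; apply: sat; rewrite inE ys orbT.
  by rewrite big_cons /= (mulrS v (size s)) (mulrS (v *+ 2)) !lerD // ltW.
have Vs : V (\sum_(x <- s) x).
  by apply: pm_sum => // x /sat[Hx _ _]; apply: valuation_cut_sub.
apply: valuation_cut_factorization.
  case: s_u => // s_u; apply: valuation_cutB => //.
    by case: uat => Hu _ _; apply: valuation_cut_sub.
  by move: sum_bounds; rewrite s_u; lra.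
have : v *+ 2 *+ size s <= v *+ 2 *+ 3 by rewrite ler_wpMn2l //; lra.
by move/andP: sum_bounds => [_]; lra.
Qed.

End ValuationCut.

Lemma puiseux_pos_exists (V : set rat) : puiseux_monoid V -> V <> [set 0] ->
  exists2 v, V v & 0 < v.
Proof.
move=> pmV V0; apply: contrapT => noV; apply: V0.
apply/seteqP; split=> [x Vx|_ ->]; last exact: pm0.
apply: contrapT => /eqP x0; apply: noV; exists x => //.
by rewrite lt_def x0 (pm_ge0 pmV).
Qed.

Lemma strongly_primary_globally_tame_exists (R : realType) (V : set rat) :
    puiseux_valuation_monoid V -> V <> [set 0] ->
  exists H : set rat,
    [/\ strongly_primary_puiseux H, complete_integral_closure H = V,
        conductor H (complete_integral_closure H) <> set0,
        quot H = quot V & globally_tame H R].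
Proof.
move=> pvV V0; have pmV := pvV.1.
have [v Vv v_gt0] := puiseux_pos_exists pmV V0.
exists (valuation_cut V v); split.
- exact: valuation_cut_strongly_primary.
- exact: valuation_cut_closure.
- by move=> c0; have := valuation_cut_conductor pvV Vv; rewrite c0.
- apply: quot_complete_integral_closure; first exact: valuation_cut_puiseux.
    exact: valuation_cut_sub.
  exact: valuation_cut_closure.
- by apply: globally_tameI => u; apply: valuation_cut_tame_bound.
Qed.

(** * Discreteness and the construction of weights *)

Lemma valuation_monoid_discrete (V : set rat) (e D : rat) :
    puiseux_valuation_monoid V -> V e -> 0 < e -> 0 < D ->
    (forall x, V x -> x * D \is a Num.int) ->
  isomorphic V [set: nat].
Proof.
move=> pvV Ve e_gt0 D_gt0 Dint; have pmV := pvV.1.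
have natD x : V x -> exists n : nat, x * D = n%:R.
  move=> Vx; apply/natrP; rewrite natrEint Dint //=.
  by apply: mulr_ge0; [apply: (pm_ge0 pmV)|apply: ltW].
(* The least positive numerator over the common denominator [D] gives an element [m] which generates
   [V], by division with remainder. *)
pose P n := `[< (0 < n)%N /\ exists2 x, V x & x * D = n%:R >].
have [|n /asboolP[n_gt0 [m Vm mD]] nmin] := @ex_minnP P.
  have [n nE] := natD e Ve; exists n; apply/asboolP; split; last by exists e.
  by rewrite -(ltr_nat rat) -nE mulr_gt0.
have m_gt0 : 0 < m by rewrite -(pmulr_lgt0 _ D_gt0) mD ltr0n.
have Vmul x : V x -> exists q : nat, x = m *+ q.
  move=> Vx; have [k kD] := natD x Vx; exists (k %/ n)%N.
  have rD : (x - m *+ (k %/ n)) * D = (k %% n)%:R.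
    rewrite mulrBl kD mulrnAl mD {1}(divn_eq k n) natrD natrM mulr_natl.
    by rewrite addrC addKr.
  apply/eqP; rewrite -subr_eq0 -(mulIr_eq0 _ (mulIf (lt0r_neq0 D_gt0))) rD.
  rewrite pnatr_eq0 -leqn0 leqNgt; apply/negP => r_gt0.
  have : (n <= k %% n)%N; last by rewrite leqNgt ltn_mod n_gt0.
  apply: nmin; apply/asboolP; split=> //; exists (x - m *+ (k %/ n)) => //.
  apply/valuation_monoid_quot => //; split.
    by exists x, (m *+ (k %/ n)); split=> //; apply: pmMn.
  by rewrite -(pmulr_lge0 _ D_gt0) rD.
pose f x := Num.truncn (x / m).
have fE q : f (m *+ q) = q by rewrite /f -mulr_natl mulfK ?gt_eqF // natrK.
exists f; split=> [|x y|]; first by rewrite /f mul0r truncn0.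
  by rewrite !inE => /Vmul[p ->] /Vmul[q ->]; rewrite -mulrnDr !fE.
split=> [//|x y|q _]; last by exists (m *+ q); rewrite ?fE //; apply: pmMn.
by rewrite !inE => /Vmul[p ->] /Vmul[q ->]; rewrite !fE => ->.
Qed.

Section Weight.
Variables (V : set rat) (e : rat).
Hypotheses (pvV : puiseux_valuation_monoid V) (Ve : V e) (e_gt0 : 0 < e).
Hypothesis not_nat : ~ isomorphic V [set: nat].

(** The subgroups [(e / k!) Z] increase with [k] and exhaust the rationals. *)
Let in_level k : pred rat := fun x => x / e * (k`!)%:R \is a Num.int.

Let in_level_mono k l x : (k <= l)%N -> in_level k x -> in_level l x.
Proof.
move=> /subnK <-; elim: (l - k)%N => // i IHi /IHi xl.
by rewrite /in_level addSn factS natrM mulrCA rpredM // natr_int.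
Qed.

Let in_level_ex x : exists k, in_level k x.
Proof.
exists `|denq (x / e)|%N; rewrite /in_level.
set d := `|_|%N; have /dvdnP[q ->] : (d %| d`!)%N.
  by apply: dvdn_fact; rewrite absz_gt0 denq_neq0 leqnn.
rewrite natrM mulrCA rpredM ?natr_int // natr_absz ger0_norm ?denq_ge0 //.
by rewrite -[X in X * _]divq_num_den divfK ?intr_eq0 ?denq_neq0 // intr_int.
Qed.

(* Some levels may be skipped; [rank] below renumbers those which occur, so that
   every natural number is a weight. *)
Let level x := ex_minn (in_level_ex x).

Let levelP x : in_level (level x) x.
Proof. by rewrite /level; case: ex_minnP. Qed.

Let level_le k x : in_level k x -> (level x <= k)%N.
Proof. by rewrite /level; case: ex_minnP => m _; apply. Qed.

Let levelB x y : (level (x - y) <= maxn (level x) (level y))%N.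
Proof.
apply: level_le; rewrite /in_level mulrBl mulrBl rpredB //.
  exact: in_level_mono (leq_maxl _ _) (levelP x).
exact: in_level_mono (leq_maxr _ _) (levelP y).
Qed.

Let attained j : bool := `[< exists2 x, quot V x & level x = j >].

(** Counts the attained levels from 1 to [n]; level 0, that of [e], is left out and so gets rank
    0. *)
Let rank n := (\sum_(i < n) attained i.+1)%N.

Let rank_mono m n : (m <= n)%N -> (rank m <= rank n)%N.
Proof.
move=> /subnKC <-; elim: (n - m)%N => [|i IHi]; first by rewrite addn0.
by rewrite addnS /rank big_ord_recr (leq_trans IHi) // leq_addr.
Qed.

(** If no level above [n] occurred, [n! / e] would clear all denominators of [V], and [V] would be
    isomorphic to [N_0]. *)
Let attained_unbounded n : exists2 j, (n < j)%N & attained j.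
Proof.
apply: contrapT => noj; apply: not_nat.
apply: (@valuation_monoid_discrete _ e ((n`!)%:R / e)) => //.
  by rewrite divr_gt0 // ltr0n fact_gt0.
move=> x Vx; have [jn|nj] := leqP (level x) n.
  by rewrite mulrA mulrAC; apply: in_level_mono jn (levelP x).
case: noj; exists (level x) => //; apply/asboolP; exists x => //.
exact: pm_quot pvV.1 _ Vx.
Qed.

Let rank_unbounded k : exists n, (k <= rank n)%N.
Proof.
elim: k => [|k [n kn]]; first by exists 0%N.
have [[|j] // nj attj] := attained_unbounded n.
exists j.+1; rewrite {1}/rank big_ord_recr /= -/(rank j) attj addn1 ltnS.
by apply: leq_trans kn _; apply: rank_mono.
Qed.

Lemma weight_exists : exists w : rat -> nat,
  [/\ w e = 0%N, forall x y : rat, (w (x - y)%R <= maxn (w x) (w y))%N &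
      forall k, exists2 x, quot V x & w x = k].
Proof.
have level_e : level e = 0%N.
  by apply/eqP; rewrite -leqn0; apply: level_le; rewrite /in_level divff ?mulr1 ?gt_eqF.
exists (rank \o level); split=> [|x y|k] /=; first by rewrite level_e /rank big_ord0.
  apply: leq_trans (rank_mono (levelB x y)) _.
  by case: (leqP (level x) (level y)) => _; rewrite leq_max leqnn ?orbT.
case: k => [|k].
  by exists e; rewrite ?level_e /rank ?big_ord0 //; apply: pm_quot pvV.1 _ Ve.
(* The first index of rank at least [k.+1] is a jump of the rank, hence an attained level. *)
have [[|n]] := ex_minnP (rank_unbounded k.+1); first by rewrite /rank big_ord0.
rewrite {1}/rank big_ord_recr /= -/(rank n) => kn nmin.
have rank_le : (rank n <= k)%N.
  by rewrite -ltnS ltnNge; apply/negP => /nmin; rewrite ltnn.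
have attn : attained n.+1 by move: kn rank_le; case: attained => //=; lia.
have /asboolP[x Vx xn] := attn; exists x => //; rewrite xn.
rewrite /rank big_ord_recr /= -/(rank n); move: kn; rewrite attn; lia.
Qed.

End Weight.

(** * Weighted monoids: empty conductor, bounded lengths and failure of global tameness *)

Section WeightedMonoid.
Variables (V : set rat) (e : rat) (w : rat -> nat).
Hypotheses (pvV : puiseux_valuation_monoid V) (Ve : V e) (e_gt0 : 0 < e).
Hypotheses (we : w e = 0%N)
  (wB : forall x y : rat, (w (x - y)%R <= maxn (w x) (w y))%N)
  (w_surj : forall k, exists2 x, quot V x & w x = k).

Let pmV : puiseux_monoid V. Proof. exact: pvV.1. Qed.

Let w0 : w 0 = 0%N.
Proof. by have := wB e e; rewrite subrr we leqn0 => /eqP. Qed.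

Let wN x : w (- x) = w x.
Proof.
have wN_le y : (w (- y) <= w y)%N by have := wB 0 y; rewrite sub0r w0 max0n.
by apply/eqP; rewrite eqn_leq wN_le -{1}[x]opprK wN_le.
Qed.

Let wD x y : (w (x + y)%R <= maxn (w x) (w y))%N.
Proof. by have := wB x (- y); rewrite opprK wN. Qed.

Let wMn x n : (w (x *+ n) <= w x)%N.
Proof.
elim: n => [|n IHn]; first by rewrite mulr0n w0.
by rewrite mulrS (leq_trans (wD _ _)) // geq_max leqnn.
Qed.

Let w_lt x y : (w x < w y)%N -> w (x + y) = w y.
Proof.
move=> xy; apply/eqP; rewrite eqn_leq (leq_trans (wD x y)) ?geq_max ?(ltnW xy) ?leqnn //=.
have := wB (x + y) x; rewrite addrC addKr leq_max => /orP[//|].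
by rewrite leqNgt xy.
Qed.

Let w_e n : w (e *+ n) = 0%N.
Proof. by apply/eqP; rewrite -leqn0 -we; apply: wMn. Qed.

Let w_shift x n : w (x + e *+ n) = w x.
Proof.
apply/eqP; rewrite eqn_leq; apply/andP; split.
  by rewrite (leq_trans (wD _ _)) // w_e maxn0.
by have := wB (x + e *+ n) (e *+ n); rewrite addrK w_e maxn0.
Qed.

Let w_shiftB x n : w (x - e *+ n) = w x.
Proof. by rewrite -[in RHS](subrK (e *+ n) x) w_shift. Qed.

Let quot_e n : quot V (e *+ n).
Proof. exact/pm_quot/pmMn. Qed.

Let e_mono m n : (m <= n)%N -> e *+ m <= e *+ n.
Proof. by move=> mn; rewrite ler_wpMn2l // ltW. Qed.

(** Multiples of [e] have weight 0, so an element of weight [k] can be shifted into [[0, e)] without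
    changing its weight. *)
Let small_weight k : exists v, [/\ quot V v, 0 <= v < e & w v = k].
Proof.
have [x Vx xk] := w_surj k.
have [n xn] := archimedean_mulrn (- x) e_gt0.
pose y := x + e *+ n; have y_ge0 : 0 <= y by rewrite /y -[x]opprK addrC subr_ge0.
pose m := Num.truncn (y / e).
have ye_ge0 : 0 <= y / e by rewrite divr_ge0 // ltW.
exists (y - e *+ m); split; last by rewrite w_shiftB w_shift.
  by apply: quotB => //; apply: quotD.
have /andP[] := truncn_itv ye_ge0.
rewrite -/m ler_pdivlMr // ltr_pdivrMr // !mulr_natl mulrSr => my ym.
by rewrite subr_ge0 my /= ltrBlDr addrC.
Qed.

Definition weighted_monoid : set rat :=
  [set x | x = 0 \/ (quot V x /\ e *+ (w x).+1 <= x)].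
Local Notation H := weighted_monoid.

Lemma weighted_monoid_ge x : H x -> x <> 0 -> e *+ (w x).+1 <= x.
Proof. by case=> [->//|[]]. Qed.

Lemma weighted_monoid_sub : H `<=` V.
Proof.
move=> x [->|[Vx wx]]; first exact: pm0.
apply/valuation_monoid_quot => //; split=> //; apply: le_trans wx.
by rewrite mulrn_wge0 // ltW.
Qed.

Let Hquot x : H x -> quot V x.
Proof. by move/weighted_monoid_sub/(pm_quot pmV). Qed.

Let He n : H (e *+ n).
Proof.
case: n => [|n]; first by left; rewrite mulr0n.
by right; split=> //; rewrite w_e; apply: e_mono.
Qed.

(** The largest weight among the summands pays for the weight of the sum, and each summand
    contributes one further [e]. *)
Lemma weighted_monoid_sum n (x : 'I_n -> rat) :
  (forall i, H (x i) /\ x i <> 0) -> e *+ (w (\sum_i x i) + n) <= \sum_i x i.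
Proof.
elim: n x => [|n IHn] x xP; first by rewrite big_ord0 w0 mulr0n.
rewrite big_ord_recr /=; set s := \sum_(i < n) _; set y := x ord_max.
have /IHn : forall i, H (x (widen_ord (leqnSn n) i)) /\ x (widen_ord (leqnSn n) i) <> 0.
  by move=> i; apply: xP.
rewrite -/s => s_ge.
have y_ge : e *+ (w y).+1 <= y by case: (xP ord_max); apply: weighted_monoid_ge.
have : e *+ (w (s + y) + n.+1) <= e *+ (maxn (w s) (w y) + n.+1).
  by apply: e_mono; rewrite leq_add2r.
move/le_trans; apply; case: (leqP (w y) (w s)) => [wys|wsy].
  rewrite addnS -addn1 mulrnDr lerD //; apply: le_trans y_ge.
  exact: e_mono.
rewrite -addSnnS addnC mulrnDr lerD //; apply: le_trans s_ge.
by apply: e_mono; apply: leq_addl.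
Qed.

Lemma weighted_monoidD x y : H x -> H y -> H (x + y).
Proof.
move=> Hx Hy.
have [->|/eqP x0] := eqVneq x 0; first by rewrite add0r.
have [->|/eqP y0] := eqVneq y 0; first by rewrite addr0.
right; split; first by apply: quotD => //; apply: Hquot.
have := @weighted_monoid_sum 2 (fun i => if i == ord0 then x else y).
rewrite !big_ord_recl big_ord0 /= addr0 => /(_ _)/(le_trans _); apply.
  by apply: e_mono; rewrite addn2.
by move=> i; case: ifP.
Qed.

Lemma weighted_monoid_puiseux : puiseux_monoid H.
Proof.
apply/puiseux_monoidP; split; [by left|exact: weighted_monoidD|].
by move=> x /weighted_monoid_sub/(pm_ge0 pmV).
Qed.

Lemma weighted_monoid_strongly_primary : strongly_primary_puiseux H.
Proof.
apply: strongly_primary_puiseuxI; first exact: weighted_monoid_puiseux.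
  by exists e; [exact: (He 1)|move/eqP; rewrite gt_eqF].
(* This [n] pays for [a] itself and for the weight of the difference, which is at most
   [w s + w a]. *)
move=> a Ha _; have [n nP] := archimedean_mulrn (a + e *+ (w a).+1) e_gt0.
exists n => x xP; have := weighted_monoid_sum xP.
have Vs : quot V (\sum_i x i).
  elim/big_ind: _ => [||i _]; [exact: quot0|exact: quotD|].
  by apply: Hquot; case: (xP i).
set s := \sum_i x i in Vs * => s_ge.
right; split; first by apply: quotB => //; apply: Hquot.
apply: (@le_trans _ _ (e *+ (w s + (w a).+1))).
  by apply: e_mono; rewrite addnS ltnS (leq_trans (wB s a)) // geq_max leq_addr leq_addl.
by rewrite lerBrDr (le_trans _ s_ge) // !mulrnDr -addrA lerD2l addrC.
Qed.

Lemma weighted_monoid_closure : complete_integral_closure H = V.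
Proof.
apply: complete_integral_closure_valuation => //.
- exact: weighted_monoid_puiseux.
- exact: weighted_monoid_sub.
(* A single constant serves all multiples of [x], as their weights do not exceed [w x]. *)
move=> x Vx; exists (e *+ (w x).+1) => // n; right.
split; first by apply: quotD => //; apply/pm_quot/pmMn.
rewrite addrC w_shift (@le_trans _ _ (e *+ (w x).+1)) ?e_mono ?ltnS //.
by rewrite lerDr mulrn_wge0 // (pm_ge0 pmV).
Qed.

Lemma weighted_monoid_conductor :
  conductor H (complete_integral_closure H) = set0.
Proof.
rewrite weighted_monoid_closure -subset0 => x [[a [b [Ha Hb xE]]] xV].
have [n xn] := archimedean_mulrn x e_gt0.
(* A weight above [w x] is inherited by [x + v]; being also above [n], it is too large for an
   element below [e *+ n.+1]. *)
have [v [Vv /andP[v0 ve] wv]] := small_weight (maxn n (w x)).+1.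
have wxv : w (x + v) = (maxn n (w x)).+1.
  by rewrite w_lt wv // ltnS leq_maxr.
have Hxv : H (x + v).
  by apply: xV; exists v => //; apply/valuation_monoid_quot.
have := weighted_monoid_ge Hxv; rewrite wxv => /(_ _)/le_gtF/negbT/negP; case.
  by move=> xv0; move: wxv; rewrite xv0 w0.
apply: (@lt_le_trans _ _ (e *+ n.+1)); first by rewrite mulrSr ler_ltD.
by apply: e_mono; rewrite !ltnS (leq_trans (leq_maxl n (w x))).
Qed.

(** A sum [x] of two nonzero elements of [H] is at least [(w x + 2) e]. *)
Lemma weighted_monoid_atom x : quot V x ->
  e *+ (w x).+1 <= x < e *+ (w x).+2 -> atoms H x.
Proof.
move=> Vx /andP[xw wx]; split; first by right.
  by move=> x0; move: xw; rewrite x0 w0 leNgt e_gt0.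
move=> a b Ha Hb a0 b0 xab; move: wx; rewrite ltNge => /negP; apply.
have := @weighted_monoid_sum 2 (fun i => if i == ord0 then a else b).
rewrite !big_ord_recl big_ord0 /= addr0 -xab addn2; apply.
by move=> i; case: ifP.
Qed.

Let atom_e : atoms H e.
Proof.
apply: weighted_monoid_atom; first exact: (quot_e 1).
by rewrite we lexx /= mulr2n ltrDl.
Qed.

(** Changing the sign and adding multiples of [e] preserve the weight [k], and both elements lie
    between [(k + 1) e] and [(k + 2) e]. *)
Let shifted_atoms k v : quot V v -> 0 < v < e -> w v = k ->
  atoms H (e *+ k.+1 + v) /\ atoms H (e *+ k.+2 - v).
Proof.
move=> Vv /andP[v0 ve] wv; split; apply: weighted_monoid_atom.
- exact: quotD.
- by rewrite addrC w_shift wv lerDr (ltW v0) /= [ltRHS]mulrSr addrC ltrD2l.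
- exact: quotB.
- rewrite addrC w_shift wN wv addrC lerBrDr [leRHS]mulrSr lerD2l (ltW ve) /=.
  by rewrite ltrBlDr ltrDl.
Qed.

Let small_weight_gt0 k : exists v, [/\ quot V v, 0 < v < e & w v = k.+1].
Proof.
have [v [Vv /andP[v0 ve] wv]] := small_weight k.+1; exists v; split=> //.
rewrite ve andbT lt_def v0 andbT; apply/eqP => v_eq0.
by move: wv; rewrite v_eq0 w0.
Qed.

(* An odd multiple [(2 k + 5) e] is the sum of the atoms [(k + 2) e + v] and
   [(k + 3) e - v], where [v] has weight [k + 1]. *)
Let factorization_e n : factorization_le H 4 (e *+ n).
Proof.
have odd_case k : factorization_le H 2 (e *+ (k.*2 + 5)).
  have [v [Vv v_e wv]] := small_weight_gt0 k.
  have [at1 at2] := shifted_atoms Vv v_e wv.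
  have -> : e *+ (k.*2 + 5) = (e *+ k.+2 + v) + (e *+ k.+3 - v).
    rewrite addrACA subrr addr0 -mulrnDr; congr (_ *+ _); lia.
  by apply: (@factorization_leD _ 1 1); apply: factorization_le_atom.
(* Up to 4, copies of [e] do; a larger odd [n] takes two atoms, and a larger even one takes [e] in
   addition. *)
have [n4|n4] := leqP n 4.
  by apply: factorization_leW n4 _; apply: factorization_le_nseq.
have [nodd|neven] := boolP (odd n).
  have -> : n = ((n - 5)./2.*2 + 5)%N by lia.
  exact: factorization_leW (odd_case _).
have -> : n = (((n - 6)./2.*2 + 5) + 1)%N by lia.
rewrite mulrnDr; apply: (@factorization_leW _ 3) => //.
exact: factorization_leD (odd_case _) (factorization_le_atom atom_e).
Qed.

(** Subtracting the largest multiple of [e] that keeps [a] at or above [(w a + 1) e] leaves one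
    atom, and the multiple takes at most 4. *)
Lemma weighted_monoid_factorization a : H a -> factorization_le H 5 a.
Proof.
move=> Ha; have [->|/eqP a0] := eqVneq a 0; first by exists [::]; rewrite big_nil.
have a_ge := weighted_monoid_ge Ha a0.
pose n := Num.truncn ((a - e *+ (w a).+1) / e).
have q_ge0 : 0 <= (a - e *+ (w a).+1) / e by rewrite divr_ge0 ?subr_ge0 // ltW.
have /andP[] := truncn_itv q_ge0.
rewrite -/n ler_pdivlMr // ltr_pdivrMr // !mulr_natl => na an.
rewrite -[a](subrK (e *+ n)).
apply: (@factorization_leD _ 1 4); last exact: factorization_e.
apply/factorization_le_atom/weighted_monoid_atom.
  by apply: quotB => //; apply: Hquot.
rewrite w_shiftB lerBrDr addrC -lerBrDr na /= ltrBlDr.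
by move: an; rewrite ltrBlDr [in X in _ -> X]mulrSr mulrSr; lra.
Qed.

(** Since [u + y = (2 k + 5) e], the element [u] must be made to appear in a sum of copies of [e].
    The copies given up sum to at least [u >= (k + 2) e], so there are more than [k] of them. *)
Lemma weighted_monoid_not_tame_bound k : exists2 u, atoms H u &
  forall N, tame_bound H u N -> (k <= N)%N.
Proof.
have [v [Vv v_e wv]] := small_weight_gt0 k.
have [at1 at2] := shifted_atoms Vv v_e wv.
set u := e *+ k.+2 + v in at1 *; set y := e *+ k.+3 - v in at2.
exists u => // N uN.
have /andP[v0 _] := v_e.
have u_ge : e *+ k.+2 <= u by rewrite lerDl ltW.
have ue : u != e.
  by apply/eqP => ue; move: wv; rewrite -(w_shift v k.+2) addrC -/u ue we.
pose m := (k.+2 + k.+3)%N.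
have uy : u + y = e *+ m by rewrite /u /y addrACA subrr addr0 -mulrnDr.
set z := seq_mset (nseq m e).
have fz : factorizations H (e *+ m) z.
  rewrite -sum_nseq; apply: factorizations_seq => x.
  by rewrite mem_nseq => /andP[_ /eqP->].
have [|z' [[z'at z'sum] uz' zN]] := uN (e *+ m) (He m) _ z fz.
  exists (seq_mset [:: u; y]); last by rewrite (perm_mem (perm_eq_seq_mset _)) mem_head.
  have := @factorizations_seq H [:: u; y]; rewrite big_cons big_seq1 uy; apply.
  by move=> x; rewrite !inE => /orP[/eqP->|/eqP->].
move: zN; rewrite /distance; set g := msetI z z'; set d := msetB z g.
rewrite geq_max => /andP[dN _]; apply: leq_trans dN.
have z_e x : x \in z -> x = e.
  by rewrite (perm_mem (perm_eq_seq_mset _)) mem_nseq => /andP[_ /eqP].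
have d_nseq : \sum_(x <- d) x = e *+ size d.
  rewrite -sum_nseq; congr (\sum_(x <- _) x); apply/all_pred1P/allP => x xd.
  by apply/eqP/z_e; move: xd; rewrite in_msetB in_mset; apply: leq_ltn_trans.
(* As [u] differs from [e], it is not in [z] and survives the removal of the common part. *)
have /perm_to_rem u_d' : u \in msetB z' g.
  rewrite in_msetB msetE2; have /mset_eq0P -> : u \notin z by apply: contra ue => /z_e ->.
  by rewrite min0n mset_gt0.
have : u <= e *+ size d.
  rewrite -d_nseq sum_msetB_msetI; last by rewrite z'sum; case: fz.
  rewrite (perm_big _ u_d') big_cons lerDl big_seq sumr_ge0 // => x /mem_rem.
  rewrite in_msetB => /(leq_ltn_trans (leq0n _)); rewrite mset_gt0 => /z'at[Hx _ _].
  exact: (pm_ge0 weighted_monoid_puiseux).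
move/(le_trans u_ge); rewrite leNgt; apply: contraNleq => dk.
apply: (@lt_le_trans _ _ (e *+ k)); first by rewrite ltr_pMn2l.
by apply: e_mono; lia.
Qed.

End WeightedMonoid.

(** * Realization with empty conductor, and the four statements together *)

Lemma strongly_primary_locally_tame_exists (R : realType) (V : set rat) :
    puiseux_valuation_monoid V -> V <> [set 0] -> ~ isomorphic V [set: nat] ->
  exists H : set rat,
    [/\ strongly_primary_puiseux H, complete_integral_closure H = V,
        (Lambda H R < +oo)%E,
        conductor H (complete_integral_closure H) = set0 &
        [/\ quot H = quot V, locally_tame H R & ~ globally_tame H R]].
Proof.
move=> pvV V0 not_nat; have [e Ve e_gt0] := puiseux_pos_exists pvV.1 V0.
have [w [we wB w_surj]] := weight_exists pvV Ve e_gt0 not_nat.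
have sp := weighted_monoid_strongly_primary pvV Ve e_gt0 we wB.
have closure := weighted_monoid_closure pvV Ve e_gt0 we wB.
have short := weighted_monoid_factorization pvV Ve e_gt0 we wB w_surj.
exists (weighted_monoid V e w); split=> //.
- exact: Lambda_lty short.
- exact: weighted_monoid_conductor.
split.
- apply: quot_complete_integral_closure closure; first by case: sp.
  exact: weighted_monoid_sub.
- exact: strongly_primary_locally_tame short.
- by apply: not_globally_tameI; apply: weighted_monoid_not_tame_bound.
Qed.

Theorem theorem3p12 (R : realType) :
  [/\
      forall (M : nmodType) (G : zmodType) (i : {additive M -> G}),
        cancellative M -> is_quotient_group i ->
        torsion_free G -> has_rank G 1 ->
        [set: M] <> invertibles [set: M] ->
        exists2 H : set rat, puiseux_monoid H & isomorphic [set: M] H,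
      forall Q : set rat, GRing.zmod_closed [in Q] ->
        exists2 V : set rat, puiseux_valuation_monoid V & quot V = Q,
      (forall V : set rat, puiseux_valuation_monoid V -> V <> [set 0] ->
         exists H : set rat,
           [/\ strongly_primary_puiseux H,
               complete_integral_closure H = V &
               conductor H (complete_integral_closure H) <> set0]) /\
      (continuum_hypothesis R ->
         iso_classes [set H | strongly_primary_puiseux H /\
                              globally_tame H R] #= [set: R]) &
      (forall V : set rat, puiseux_valuation_monoid V -> V <> [set 0] ->
         ~ isomorphic V [set: nat] ->
         exists H : set rat,
           [/\ strongly_primary_puiseux H,
               complete_integral_closure H = V,
               (Lambda H R < +oo)%E &
               conductor H (complete_integral_closure H) = set0]) /\
      (continuum_hypothesis R ->
         iso_classes [set H | [/\ strongly_primary_puiseux H,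
                                  locally_tame H R &
                                  ~ globally_tame H R]] #= [set: R])].
Proof.
split=> [M G i _ qG tfG rkG|Q Qz||]; first exact: rank_one_puiseux qG tfG rkG.
- have [pvV quotV] := nonneg_valuation_monoid Qz.
  by exists [set x | Q x /\ 0 <= x].
- split=> [V pvV V0|_].
    have [H [spH closure cond _ _]] := strongly_primary_globally_tame_exists R pvV V0.
    by exists H.
  apply: card_iso_classes => [H [[]]//|V pvV V0 _].
  have [H [spH _ _ quotH gtH]] := strongly_primary_globally_tame_exists R pvV V0.
  by exists H.
split=> [V pvV V0 not_nat|_].
  have [H [spH closure lam cond _]] :=
    strongly_primary_locally_tame_exists R pvV V0 not_nat.
  by exists H.
apply: card_iso_classes => [H [[]]//|V pvV V0 not_nat].
have [H [spH _ _ _ [quotH ltH ngtH]]] :=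
  strongly_primary_locally_tame_exists R pvV V0 not_nat.
by exists H.
Qed.
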